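(* Let $K$ be an infinite hyperbolic, residually finite group with Kazhdan's Property (T). Let $P$ be the group of all permutations of the set $K$ which move only finitely many elements, and let $Q$ be the subgroup of the symmetric group $\mathrm{Sym}(K)$ generated by $P$ and by the left translations $x\mapsto kx$ by the elements $k\in K$. Then $Q$ is a finitely generated sofic group, but $Q$ is not residually amenable.
   Context: For a finite set $A$ let $\mathrm{Map}(A)$ denote the monoid of all self-maps of $A$, acting on the right: write $a\cdot f$ for $f(a)$, so $a\cdot fg=(a\cdot f)\cdot g=g(f(a))$. For a real number $\epsilon\in(0,1)$, two elements $e,f\in\mathrm{Map}(A)$ are $\epsilon$-similar if the number of points $a\in A$ with $a\cdot e\neq a\cdot f$ is at most $\epsilon|A|$. They are $(1-\epsilon)$-different if they are not $(1-\epsilon)$-similar. Let $G$ be a group, $\epsilon\in(0,1)$ and $F\subseteq G$ a finite subset. An $(F,\epsilon)$-quasi-action of $G$ on a finite set $A$ is a function $\phi:G\to\mathrm{Map}(A)$ such that: (a) for any two elements $e,f\in F$ the map $\phi(ef)$ is $\epsilon$-similar to $\phi(e)\phi(f)$; (b) $\phi(1)$ is $\epsilon$-similar to the identity map of $A$; (c) for each $e\in F\setminus\{1\}$ the map $\phi(e)$ is $(1-\epsilon)$-different from the identity map of $A$. The group $G$ is sofic if for each $\epsilon\in(0,1)$ and each finite subset $F\subseteq G$ there exists an $(F,\epsilon)$-quasi-action of $G$ on some finite set. A group $G$ is residually amenable if for each $1\neq g\in G$ there is a homomorphism $\phi$ from $G$ onto an amenable (discrete) group with $\phi(g)\neq 1$.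 ''Hyperbolic'' means word-hyperbolic in the sense of Gromov. *)

(* Defs.v *)
From HB Require Import structures.
From mathcomp Require Import all_boot all_order all_algebra all_fingroup.
From mathcomp Require Import sesquilinear complex.
From mathcomp Require Import all_classical all_reals all_analysis.

Set Implicit Arguments.
Unset Strict Implicit.
Unset Printing Implicit Defensive.

Import Order.TTheory GRing.Theory Num.Theory numFieldNormedType.Exports.

Local Open Scope classical_set_scope.
Local Open Scope ring_scope.

Definition gen_subgroup (G : groupType) (X : set G) : set G :=
  smallest (fun M : set G => group_closed [in M]) X.

Lemma gen_subgroup_closed (G : groupType) (X : set G) :
  group_closed [in gen_subgroup X].
Proof.
split=> [|x y].
  by rewrite !inE => M [[M1 _] _]; rewrite inE in M1.
rewrite !inE => Xx Xy M MX; have [[_ Mdiv] _] := MX.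
by have := Mdiv x y; rewrite !inE; apply; [exact: Xx|exact: Xy].
Qed.

Definition subgroup_of (G : groupType) (X : set G) : Type :=
  {x : G | x \in gen_subgroup X}.

HB.instance Definition _ (G : groupType) (X : set G) :=
  SubChoice.on (subgroup_of X).
HB.instance Definition _ (G : groupType) (X : set G) :=
  SubChoice_isSubGroup.Build G [in gen_subgroup X] (subgroup_of X)
    (gen_subgroup_closed X).

Definition finitely_generated (G : groupType) : Prop :=
  exists S : set G, finite_set S /\ gen_subgroup S = [set: G].

(* [sym T] is Sym(T), acting on the right as [{perm _}] does:
   [(s * t) x = t (s x)].  The other convention gives the opposite group, which is
   isomorphic to this one by inversion and has the same subgroups. *)
Record sym (T : Type) := Sym {
  sym_fun :> T -> T;
  sym_inv : T -> T;
  sym_funK : cancel sym_fun sym_inv;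
  sym_invK : cancel sym_inv sym_fun }.

HB.instance Definition _ (T : Type) := gen_eqMixin (sym T).
HB.instance Definition _ (T : Type) := gen_choiceMixin (sym T).

Section SymGroup.
Variable T : Type.
Implicit Types s t u : sym T.

Lemma sym_ext s t : s =1 t -> s = t.
Proof.
case: s t => [f f' fK f'K] [g g' gK g'K] /= /funext fg; subst g.
have f'g' : f' = g' by apply/funext => x; rewrite -[x in LHS]g'K fK.
by subst g'; congr Sym; exact: Prop_irrelevance.
Qed.

Definition sym_id : sym T := @Sym T id id (frefl _) (frefl _).
Definition sym_comp s t : sym T :=
  Sym (can_comp (sym_funK t) (sym_funK s)) (can_comp (sym_invK s) (sym_invK t)).
Definition sym_opp s : sym T := Sym (sym_invK s) (sym_funK s).

Lemma sym_compA : associative sym_comp. Proof. by move=> s t u; exact: sym_ext. Qed.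
Lemma sym_comp1s : left_id sym_id sym_comp. Proof. by move=> s; exact: sym_ext. Qed.
Lemma sym_comps1 : right_id sym_id sym_comp. Proof. by move=> s; exact: sym_ext. Qed.
Lemma sym_compVs : left_inverse sym_id sym_opp sym_comp.
Proof. by move=> s; apply: sym_ext => x; exact: sym_invK. Qed.
Lemma sym_compsV : right_inverse sym_id sym_opp sym_comp.
Proof. by move=> s; apply: sym_ext => x; exact: sym_funK. Qed.

HB.instance Definition _ := isGroup.Build (sym T)
  sym_compA sym_comp1s sym_comps1 sym_compVs sym_compsV.

Definition finitary_sym : set (sym T) :=
  [set s : sym T | finite_set [set x | s x <> x]].

End SymGroup.

Definition left_translation (K : groupType) (k : K) : sym K :=
  Sym (mulKg k) (mulVKg k).

Definition groupQ (K : groupType) : groupType :=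
  subgroup_of (@finitary_sym K `|` range (@left_translation K)).

Section Sofic.
Variable R : realType.

Definition similar (eps : R) (A : finType) (e f : A -> A) : Prop :=
  #|[pred a | e a != f a]|%:R <= eps * #|A|%:R.

Definition different (eps : R) (A : finType) (e f : A -> A) : Prop :=
  ~ similar eps e f.

(* Map(A) acts on the right, so that the product [phi e * phi f] applies
   [phi e] first. *)
Definition quasi_action (G : groupType) (F : set G) (eps : R) (A : finType)
    (phi : G -> A -> A) : Prop :=
  [/\ forall e f, F e -> F f -> similar eps (phi (e * f)%g) (phi f \o phi e),
      similar eps (phi 1%g) id
    & forall e, F e -> e <> 1%g -> different (1 - eps) (phi e) id].

Definition sofic (G : groupType) : Prop :=
  forall (eps : R) (F : set G), 0 < eps < 1 -> finite_set F ->
  exists (A : finType) (phi : G -> A -> A), quasi_action F eps phi.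

End Sofic.

Definition residually_finite (G : groupType) : Prop :=
  forall g : G, g <> 1%g ->
  exists (H : finGroupType) (phi : {multiplicative G -> H}), phi g <> 1%g.

Definition amenable (R : realType) (G : groupType) : Prop :=
  exists mu : set G -> R,
  [/\ mu [set: G] = 1,
      forall A, 0 <= mu A,
      forall A B, A `&` B = set0 -> mu (A `|` B) = mu A + mu B
    & forall (g : G) A, mu [set (g * x)%g | x in A] = mu A].

Definition residually_amenable (R : realType) (G : groupType) : Prop :=
  forall g : G, g <> 1%g ->
  exists (H : groupType) (phi : {multiplicative G -> H}),
  [/\ amenable R H, range phi = [set: H] & phi g <> 1%g].

Section Hyperbolic.
Variables (R : realType) (G : groupType).

Definition is_word (S : set G) (w : seq G) : Prop :=
  forall x, x \in w -> S x \/ S (x^-1)%g.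

Definition word_lengths (S : set G) (g : G) : set nat :=
  [set size w | w in [set w : seq G | is_word S w /\ (\prod_(x <- w) x)%g = g]].

(* The default value 0 is never used when S generates G. *)
Definition word_length (S : set G) (g : G) : nat :=
  xget 0%N [set n | word_lengths S g n /\
                    forall m, word_lengths S g m -> (n <= m)%N].

Definition word_dist (S : set G) (x y : G) : R :=
  (word_length S (x^-1 * y)%g)%:R.

Definition gromov_product (d : G -> G -> R) (w x y : G) : R :=
  (d x w + d y w - d x y) / 2.

(* Gromov's four-point inequality, for the word metric on the vertices of a
   Cayley graph. *)
Definition hyperbolic : Prop :=
  exists (S : set G) (delta : R),
  [/\ finite_set S, gen_subgroup S = [set: G], 0 <= delta
    & forall w x y z, let gp := gromov_product (word_dist S) w in
      Num.min (gp x z) (gp z y) - delta <= gp x y].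

End Hyperbolic.

(* A complex Hilbert space is a complete normed module over R[i] whose norm
   comes from a scalar product [dot]. *)
Definition hilbert_dot (R : realType) (H : completeNormedModType R[i])
    (dot : {dot H for Num.conj}) : Prop :=
  forall v : H, dot v v = `|v| ^+ 2.

Definition unitary_rep (R : realType) (H : completeNormedModType R[i])
    (dot : {dot H for Num.conj}) (G : groupType) (pi : G -> {linear H -> H}) :
    Prop :=
  [/\ forall v, pi 1%g v = v,
      forall g h v, pi (g * h)%g v = pi g (pi h v)
    & forall g u v, dot (pi g u) (pi g v) = dot u v].

(* Existence of a Kazhdan pair (S, eps); the compact subsets of a discrete group
   are its finite subsets. *)
Definition property_T (R : realType) (G : groupType) : Prop :=
  exists (S : set G) (eps : R),
  [/\ finite_set S, 0 < eps
    & forall (H : completeNormedModType R[i]) (dot : {dot H for Num.conj})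
             (pi : G -> {linear H -> H}),
      hilbert_dot dot -> unitary_rep dot pi ->
      (exists v : H, v != 0 /\
         forall s, S s -> `|pi s v - v| < (eps%:C)%C * `|v|) ->
      exists v : H, v != 0 /\ forall g, pi g v = v].

(* Main.v *)
Require Import Defs.
From HB Require Import structures.
From mathcomp Require Import all_boot all_order all_algebra all_fingroup.
From mathcomp Require Import finmap sesquilinear complex.
From mathcomp Require Import all_classical all_reals all_analysis.
From mathcomp Require Import showcase.summability.
From mathcomp Require Import ring lra zify.

(** Write L for the left translations of K, and recall that an element of Q
    agrees with a left translation outside a finite set.

    Finite generation.  If S generates K, then Q is generated by the
    translations by elements of S and the transpositions of 1 with an element
    of S: conjugating by translations gives the transposition along every edge
    of the Cayley graph of K, hence every transposition because that graph is
    connected, hence every finitary permutation.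

    Soficity.  A finite quotient K -> H that is injective on a large finite
    window of K lets each q in a finite part of Q act on H: by q itself on the
    image of the window, by the image of its translation part elsewhere
    ([finite_model]).  On the given finite part these permutations of H
    multiply as in Q and are nontrivial for nontrivial q
    ([finite_modelM], [finite_model_in]), so Q is locally embeddable into
    finite groups.  Right multiplication on Sym(H) is then a quasi-action that
    is exact and without fixed points ([groupQ_sofic]).

    Failure of residual amenability.  Let phi be a morphism from Q onto an
    amenable group H.  Through phi the property (T) group K acts on the
    amenable group H by left multiplication, and this forces phi(L(K)) to be
    finite ([propertyT_amenable_finite_range]).  As K is infinite, phi(L_m) = 1
    for infinitely many m in K.  Conjugation by L_m moves the transposition
    (x y) to (mx my), so phi takes the same value on both; if mx and my avoid
    y and z, a further conjugation by (y z) shows that phi also takes this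
    value on (x z).  Hence phi kills the 3-cycle (x y)(x z), for fixed distinct
    points x, y, z and every such phi.

    Property (T) against amenability.  Suppose phi(L(K)) is infinite.  Then the
    unitary representation of K on l2(H) has no nonzero invariant vector, since
    an invariant function is constant on infinite orbits.  Property (T),
    applied to the indicator functions of finite subsets A of H, yields a
    finite subset S of K and d > 0 such that some s in S moves at least d #|A|
    points of A outside A ([propertyT_expansion]).  Iterating, a finite subset
    U of K satisfies #|UA| >= 2 #|A| for all finite A ([expansion_doubling]).
    The marriage theorem for infinite families of finite sets ([Hall_Rado])
    then gives two injections of H into itself with disjoint images, each of
    which is piecewise a translation by an element of U.  An invariant mean
    gives both images mass 1, which is absurd ([mean_no_doubling]).

    The scalar product of l2(H), a Hilbert space over R[i], is a limit of finite
    sums along the filter of finite subsets of H.  Completeness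
    ([l2_complete]) follows from pointwise convergence, because the norm is a
    supremum of norms that involve finitely many coordinates. *)

Set Implicit Arguments.
Unset Strict Implicit.
Unset Printing Implicit Defensive.

Import Order.TTheory GRing.Theory Num.Theory numFieldNormedType.Exports.

Local Open Scope classical_set_scope.
Local Open Scope ring_scope.
#[local] Existing Instance totally_filter.

(** * Group morphisms and generated subgroups *)

Section GroupGeneralities.
Local Open Scope group_scope.

Section Multiplicative.
Variables (G H : groupType) (phi : {multiplicative G -> H}).

Lemma multiplicative1 : phi 1 = 1.
Proof. by apply: (mulgI (phi 1)); rewrite -gmulfM !mulg1. Qed.

Lemma multiplicativeV g : phi g^-1 = (phi g)^-1.
Proof. by apply: (mulgI (phi g)); rewrite -gmulfM !mulgV multiplicative1. Qed.

Lemma multiplicativeJ g h : phi (h^-1 * g * h) = (phi h)^-1 * phi g * phi h.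
Proof. by rewrite !gmulfM multiplicativeV. Qed.
End Multiplicative.

Section Generation.
Variables (G : groupType) (X : set G).

Lemma sub_gen_subgroup : X `<=` gen_subgroup X.
Proof. exact: sub_smallest. Qed.

Lemma gen_subgroup1 : gen_subgroup X 1.
Proof. by have [] := gen_subgroup_closed X; rewrite inE. Qed.

Lemma gen_subgroupF x y :
  gen_subgroup X x -> gen_subgroup X y -> gen_subgroup X (x * y^-1).
Proof. by have [_ /(_ x y)] := gen_subgroup_closed X; rewrite !inE. Qed.

Lemma gen_subgroupV x : gen_subgroup X x -> gen_subgroup X x^-1.
Proof. by move=> /(gen_subgroupF gen_subgroup1); rewrite mul1g. Qed.

Lemma gen_subgroupM x y :
  gen_subgroup X x -> gen_subgroup X y -> gen_subgroup X (x * y).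
Proof. by move=> Xx /gen_subgroupV /(gen_subgroupF Xx); rewrite invgK. Qed.

Lemma gen_subgroup_ind (P : set G) : X `<=` P -> P 1 ->
  (forall x y, P x -> P y -> P (x * y^-1)) -> gen_subgroup X `<=` P.
Proof.
move=> XP P1 PF x; apply; split => //; split; first by rewrite inE.
by move=> a b; rewrite !inE; exact: PF.
Qed.

End Generation.

End GroupGeneralities.

(** * Unconditional sums of real families *)

Section Sums.
Context {R : realType} {X : choiceType}.
Implicit Types (a b : X -> R) (A B : {fset X}).

Definition psum a A : R := \sum_(x <- A) a x.
(** Over the reals, unconditional summability is the same as boundedness of the
    finite partial sums of absolute values, which is easier to transport. *)
Definition bdd_sum a := exists M, forall A, psum (fun x => `|a x|) A <= M.
Definition usum a : R := lim (psum a @ totally).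

Lemma psum_subset a A B : (forall x, 0 <= a x) -> (A `<=` B)%fset ->
  psum a A <= psum a B.
Proof.
move=> a0 AB; rewrite /psum (big_fsetID _ (mem A) B)/=.
rewrite (_ : [fset x in B | x \in A]%fset = A); last first.
  apply/fsetP => x; rewrite !inE /=.
  by case: (boolP (x \in A)) => [/(fsubsetP AB)->|]; rewrite ?andbF.
by rewrite lerDl sumr_ge0.
Qed.

Lemma psumD a b A : psum (fun x => a x + b x) A = psum a A + psum b A.
Proof. exact: big_split. Qed.
Lemma psumZ c a A : psum (fun x => c * a x) A = c * psum a A.
Proof. by rewrite /psum big_distrr. Qed.
Lemma ler_psum a b A : (forall x, a x <= b x) -> psum a A <= psum b A.
Proof. by move=> ab; apply: ler_sum. Qed.

Lemma bdd_sum_le a b : (forall x, `|a x| <= b x) ->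
  (exists M, forall A, psum b A <= M) -> bdd_sum a.
Proof. by move=> ab [M bM]; exists M => A; apply: le_trans (bM A); exact: ler_psum. Qed.

Lemma bdd_sumD a b : bdd_sum a -> bdd_sum b -> bdd_sum (fun x => a x + b x).
Proof.
move=> [M aM] [N bN]; apply: (@bdd_sum_le _ (fun x => `|a x| + `|b x|)).
  by move=> x; exact: ler_normD.
by exists (M + N) => A; rewrite psumD lerD.
Qed.

Lemma bdd_sumZ c a : bdd_sum a -> bdd_sum (fun x => c * a x).
Proof.
move=> [M aM]; apply: (@bdd_sum_le _ (fun x => `|c| * `|a x|)).
  by move=> x; rewrite normrM.
by exists (`|c| * M) => A; rewrite psumZ ler_wpM2l.
Qed.

Lemma is_cvg_psum_ge0 a : (forall x, 0 <= a x) -> bdd_sum a -> cvg (psum a @ totally).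
Proof.
move=> a0 [M aM].
have {}aM A : psum a A <= M.
  by apply: le_trans (aM A); apply: ler_psum => x; exact: ler_norm.
have hs : has_sup (range (psum a)).
  by split; [exists (psum a fset0), fset0|exists M => _ [A _ <-]].
apply/cvg_ex; exists (sup (range (psum a))).
apply/cvgrPdist_le => /= e e0.
have [_ [A _ <-] hA] := sup_adherent e0 hs.
exists A => //= B /= AB; rewrite ger0_norm ?subr_ge0; last first.
  by apply: sup_upper_bound => //; exists B.
rewrite lerBlDl -lerBlDr (le_trans (ltW hA))//.
exact: psum_subset.
Qed.

(** The case of a general family reduces to monotone convergence by writing
    [a] as the difference of the nonnegative families [|a| + a] and [|a|]. *)
Lemma is_cvg_psum a : bdd_sum a -> cvg (psum a @ totally).
Proof.
move=> ba.
have bn : bdd_sum (fun x => `|a x|).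
  by apply: (@bdd_sum_le _ (fun x => `|a x|)) => // x; rewrite normr_id.
have c1 := is_cvg_psum_ge0 (fun x => normr_ge0 (a x)) bn.
have c2 : cvg (psum (fun x => `|a x| + a x) @ totally).
  apply: is_cvg_psum_ge0; last exact: bdd_sumD.
  by move=> x; have := ler_norm (- a x); rewrite normrN; lra.
have -> : psum a = psum (fun x => `|a x| + a x) \- psum (fun x => `|a x|).
  by apply/funext => A /=; rewrite psumD addrAC subrr add0r.
have FF : ProperFilter (@totally X) := totally_filter.
exact: is_cvgB.
Qed.

Lemma usumD a b : bdd_sum a -> bdd_sum b ->
  usum (fun x => a x + b x) = usum a + usum b.
Proof.
move=> /is_cvg_psum ca /is_cvg_psum cb; rewrite /usum -limD//.
suff -> : psum (fun x => a x + b x) = psum a + psum b by [].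
by apply/funext => A; rewrite psumD.
Qed.

Lemma usumZ c a : bdd_sum a -> usum (fun x => c * a x) = c * usum a.
Proof.
move=> /is_cvg_psum ca; apply/cvg_lim => //.
have -> : psum (fun x => c * a x) = cst c \* psum a.
  by apply/funext => A; rewrite psumZ.
exact: cvgM (cvg_cst c) ca.
Qed.

Lemma usum_le a M : bdd_sum a -> (forall A, psum a A <= M) -> usum a <= M.
Proof. by move=> /is_cvg_psum ca aM; apply: limr_le => //; apply: nearW. Qed.

Lemma psum_le_usum a A : (forall x, 0 <= a x) -> bdd_sum a -> psum a A <= usum a.
Proof.
move=> a0 /is_cvg_psum ca; apply: limr_ge => //.
by exists A => // B /= AB; exact: psum_subset.
Qed.

Lemma usum_ge0 a : (forall x, 0 <= a x) -> bdd_sum a -> 0 <= usum a.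
Proof. by move=> a0 ba; have := psum_le_usum fset0 a0 ba; rewrite /psum big_seq_fset0. Qed.

Lemma usum_finite a A : (forall x, x \notin A -> a x = 0) -> usum a = psum a A.
Proof.
move=> aA; apply/cvg_lim => //; apply/cvgrPdist_le => e e0.
exists A => //= B /= AB; rewrite (_ : psum a B = psum a A) ?subrr ?normr0 ?ltW//.
rewrite /psum; symmetry; apply: big_fset_incl => // x _ xA; exact: aA.
Qed.

Lemma bdd_sum_finite a A : (forall x, x \notin A -> a x = 0) -> bdd_sum a.
Proof.
move=> aA; exists (psum (fun x => `|a x|) A) => B.
apply: (@le_trans _ _ (psum (fun x => `|a x|) (A `|` B)%fset)).
  by apply: psum_subset => //; exact: fsubsetUr.
rewrite le_eqVlt; apply/orP; left; apply/eqP; symmetry.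
by apply: big_fset_incl; [exact: fsubsetUl|move=> x _ /aA ->; rewrite normr0].
Qed.

Lemma psum_reindex (s : X -> X) a A : injective s ->
  psum (a \o s) A = psum a (s @` A)%fset.
Proof. by move=> si; rewrite /psum big_imfset//= => x y _ _; exact: si. Qed.

Lemma bdd_sum_reindex (s : X -> X) a : injective s -> bdd_sum a -> bdd_sum (a \o s).
Proof.
by move=> si [M aM]; exists M => A; rewrite (psum_reindex (fun x => `|a x|)).
Qed.

(** A bijection of the index set maps the filter of finite subsets to itself;
    this is what makes permutation representations unitary. *)
Lemma usum_reindex (s t : X -> X) a : cancel s t -> cancel t s -> bdd_sum a ->
  usum (a \o s) = usum a.
Proof.
move=> sK tK /is_cvg_psum ca; apply/cvg_lim => //.
have -> : psum (a \o s) = psum a \o (fun A => (s @` A)%fset).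
  by apply/funext => A; rewrite psum_reindex//; exact: can_inj sK.
apply: cvg_comp ca => P [A _ AP]; exists (t @` A)%fset => //= B AB.
apply: AP => /=; apply/fsubsetP => x xA; apply/imfsetP; exists (t x) => //=.
by apply: (fsubsetP AB); apply/imfsetP; exists x.
Qed.

End Sums.

(** * The Hilbert space of square-summable functions *)

Local Notation Re := (@complex.Re _).
Local Notation Im := (@complex.Im _).

Section SquareSummable.
Variables (R : realType) (X : choiceType).
Implicit Types (f g h : X -> R[i]).

(** The real part of [f x * (g x)^*].  Working with this real quantity keeps all
    limits inside the real field; the imaginary part is recovered from
    multiplication by the imaginary unit. *)
Definition reprod f g x : R := Re (f x) * Re (g x) + Im (f x) * Im (g x).

Definition square_summable : {pred X -> R[i]} :=
  [pred f | `[< bdd_sum (reprod f f) >]].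

Lemma square_summableP f : f \in square_summable <-> bdd_sum (reprod f f).
Proof. by split=> /asboolP. Qed.

Lemma reprod_ge0 f x : 0 <= reprod f f x.
Proof. by rewrite /reprod -!expr2 addr_ge0 ?sqr_ge0. Qed.

Lemma bdd_reprod f g : f \in square_summable -> g \in square_summable ->
  bdd_sum (reprod f g).
Proof.
move=> /square_summableP[M fM] /square_summableP[N gN].
apply: (@bdd_sum_le _ _ _ (fun x => reprod f f x + reprod g g x)); last first.
  exists (M + N) => A; rewrite psumD lerD//.
    by apply: le_trans (fM A); apply: ler_psum => x; exact: ler_norm.
  by apply: le_trans (gN A); apply: ler_psum => x; exact: ler_norm.
move=> x; rewrite /reprod.
have [a b c d] : [/\ 0 <= (Re (f x) + Re (g x))^+2,  0 <= (Re (f x) - Re (g x))^+2,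
  0 <= (Im (f x) + Im (g x))^+2 & 0 <= (Im (f x) - Im (g x))^+2] by split; exact: sqr_ge0.
rewrite ler_norml; apply/andP; split; nra.
Qed.

Lemma square_summable_submod : submod_closed square_summable.
Proof.
split.
  apply/square_summableP; exists 0 => A.
  by rewrite /psum big1// => x _; rewrite /reprod /= !mul0r addr0 normr0.
move=> c f g fS gS; apply/square_summableP.
have -> : reprod (c *: f + g) (c *: f + g) =
  fun x => (Re c ^+ 2 + Im c ^+ 2) * reprod f f x + (reprod g g x +
   (2 * Re c * reprod f g x + (- 2 * Im c) * reprod f (fun x => 'i%C * (g x) : R[i]) x)).
  apply/funext => x; rewrite /reprod /=.
  rewrite !fctE.
  case: (f x) => a b; case: (g x) => a' b'; case: c => p q /=; ring.
have igS : (fun x => 'i%C * (g x) : R[i]) \in square_summable.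
  move: gS => /square_summableP bg; apply/square_summableP.
  congr bdd_sum: bg; apply/funext => x; rewrite /reprod; case: (g x) => a b /=; ring.
apply: bdd_sumD; first by apply: bdd_sumZ; exact: bdd_reprod.
apply: bdd_sumD; first exact: bdd_reprod.
by apply: bdd_sumD; apply: bdd_sumZ; exact: bdd_reprod.
Qed.

HB.instance Definition _ := GRing.isSubmodClosed.Build R[i] (X -> R[i])
  square_summable square_summable_submod.

Definition l2 := {f : X -> R[i] | f \in square_summable}.
HB.instance Definition _ := SubChoice.on l2.
HB.instance Definition _ := [SubChoice_isSubLmodule of l2 by <:].

Implicit Types u v w : l2.

(** The underlying real scalar product. *)
Definition rdot u v : R := usum (reprod (val u) (val v)).
(** The imaginary part of the hermitian product of [u] and [v] is the real
    scalar product of [u] with ['i *: v], because ['i] is conjugated in the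
    second argument. *)
Definition hdot u v : R[i] := Complex (rdot u v) (rdot u ('i%C *: v)).

Lemma bdd_reprod_l2 u v : bdd_sum (reprod (val u) (val v)).
Proof. by apply: bdd_reprod; exact: valP. Qed.

Lemma rdotC u v : rdot u v = rdot v u.
Proof.
rewrite /rdot; congr usum; apply/funext => x.
by rewrite /reprod [X in X + _]mulrC [X in _ + X]mulrC.
Qed.

Lemma rdotZDl (c : R[i]) u w v :
  rdot (c *: u + w) v = Re c * rdot u v - Im c * rdot u ('i%C *: v) + rdot w v.
Proof.
have -> : rdot (c *: u + w) v = usum (fun x => Re c * reprod (val u) (val v) x +
    (- Im c * reprod (val u) (val ('i%C *: v)) x + reprod (val w) (val v) x)).
  congr usum; apply/funext => x; rewrite /reprod /= !fctE.
  case: (val u x) => a b; case: (val v x) => a' b'; case: (val w x) => d e.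
  by case: c => p q /=; ring.
have bu t := bdd_reprod_l2 u t; have bw := bdd_reprod_l2 w v.
have bZ t k : bdd_sum (fun x => k * reprod (val u) (val t) x) := bdd_sumZ k (bu t).
rewrite usumD//; last exact: bdd_sumD.
by rewrite usumD// !usumZ// mulNr addrA.
Qed.

Lemma rdotDl u w v : rdot (u + w) v = rdot u v + rdot w v.
Proof. by rewrite -[u in LHS]scale1r rdotZDl /= mul1r mul0r subr0. Qed.

Lemma rdotDr u w v : rdot v (u + w) = rdot v u + rdot v w.
Proof. by rewrite rdotC rdotDl !(rdotC v). Qed.

Lemma rdot0 u : rdot u 0 = 0.
Proof. by have := rdotDr 0 0 u; rewrite addr0; lra. Qed.

Lemma rdotZr (c : R) u v : rdot u (c%:C%C *: v) = c * rdot u v.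
Proof.
by rewrite rdotC -[_ *: _]addr0 rdotZDl /= mul0r subr0 (rdotC 0) rdot0 addr0 rdotC.
Qed.

Lemma rdotNr u v : rdot u (- v) = - rdot u v.
Proof. by have := rdotDr v (- v) u; rewrite subrr rdot0; lra. Qed.

Lemma rdot_scale (c : R[i]) u :
  rdot (c *: u) (c *: u) = (Re c ^+ 2 + Im c ^+ 2) * rdot u u.
Proof.
rewrite /rdot -usumZ; last exact: bdd_reprod_l2.
congr usum; apply/funext => x; rewrite /reprod /= !fctE.
by case: (val u x) => a b; case: c => p q /=; ring.
Qed.

Lemma rdot_iC u v : rdot u ('i%C *: v) = - rdot v ('i%C *: u).
Proof.
rewrite /rdot -mulN1r -usumZ; last exact: bdd_reprod_l2.
congr usum; apply/funext => x; rewrite /reprod /= !fctE.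
by case: (val u x) => a b; case: (val v x) => a' b' /=; ring.
Qed.

Lemma rdot_ge0 u : 0 <= rdot u u.
Proof. by apply: usum_ge0; [exact: reprod_ge0|exact: bdd_reprod_l2]. Qed.

Lemma rdot_eq0 u : rdot u u = 0 -> u = 0.
Proof.
move=> u0; apply: val_inj; apply/funext => x /=.
have := psum_le_usum [fset x]%fset (reprod_ge0 (val u)) (bdd_reprod_l2 u u).
rewrite -/(rdot u u) u0 /psum big_seq_fset1 /reprod => h.
have {h} [a0 b0] : Re (val u x) = 0 /\ Im (val u x) = 0 by split; nra.
by apply/eqP; rewrite eq_complex a0 b0 !eqxx.
Qed.

Lemma hdot_linl v : linear_for *%R (hdot^~ v).
Proof.
move=> c u w; rewrite /hdot !rdotZDl scalerA (_ : 'i%C * 'i%C = -1 :> R[i]); last first.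
  by rewrite -expr2 sqr_i.
rewrite scaleN1r rdotNr.
by case: c => p q /=; congr Complex; ring.
Qed.

Lemma hdotC u v : hdot u v = (-1) ^+ false * Num.conj (hdot v u).
Proof.
by rewrite expr0 mul1r /hdot rdotC rdot_iC.
Qed.

Lemma hdot_linr u : linear_for (Num.conj \; *%R) (hdot u).
Proof.
move=> c v w; rewrite hdotC hdot_linl /= expr0 mul1r rmorphD rmorphM /=.
by rewrite [hdot u v]hdotC [hdot u w]hdotC expr0 !mul1r.
Qed.

HB.instance Definition _ := bilinear_isBilinear.Build R[i] l2 l2 R[i] _ _ hdot
  (hdot_linl, hdot_linr).
HB.instance Definition _ :=
  isHermitianSesquilinear.Build R[i] l2 false Num.conj hdot hdotC.

Lemma rdot_i0 u : rdot u ('i%C *: u) = 0.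
Proof. by have := rdot_iC u u; lra. Qed.

Lemma hdotE u : hdot u u = (rdot u u)%:C%C.
Proof. by rewrite /hdot rdot_i0. Qed.

Lemma rdot_gt0 u : u != 0 -> 0 < rdot u u.
Proof.
by move=> u0; rewrite lt0r rdot_ge0 andbT; apply: contra_neq u0; exact: rdot_eq0.
Qed.

Lemma hdot_gt0 u : u != 0 -> 0 < hdot u u.
Proof. by move=> u0; rewrite hdotE ltcR rdot_gt0. Qed.

HB.instance Definition _ := isDotProduct.Build R[i] l2 hdot hdot_gt0.

Definition l2norm u : R[i] := (Num.sqrt (rdot u u))%:C%C.

(** With [a] and [b] the norms of [u] and [v], the vector [b *: u - a *: v] has
    nonnegative square norm, which expands to the claim times [2 * a * b]. *)
Lemma rdot_CauchySchwarz u v :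
  rdot u v <= Num.sqrt (rdot u u) * Num.sqrt (rdot v v).
Proof.
have [->|u0] := eqVneq u 0; first by rewrite rdotC !rdot0 sqrtr0 mul0r.
have [->|v0] := eqVneq v 0; first by rewrite !rdot0 sqrtr0 mulr0.
set a := Num.sqrt _; set b := Num.sqrt _.
have a0 : 0 < a by rewrite sqrtr_gt0 rdot_gt0.
have b0 : 0 < b by rewrite sqrtr_gt0 rdot_gt0.
have aE : rdot u u = a ^+ 2 by rewrite sqr_sqrtr ?rdot_ge0.
have bE : rdot v v = b ^+ 2 by rewrite sqr_sqrtr ?rdot_ge0.
have := rdot_ge0 (b%:C%C *: u + (- a)%:C%C *: v).
rewrite !rdotDr !rdotZr !(rdotC (_ + _)) !rdotDr !rdotZr aE bE (rdotC v u).
have ab0 : 0 < a * b by rewrite mulr_gt0.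
move=> h; rewrite -(ler_pM2l ab0); nra.
Qed.

Lemma l2norm_triangle u v : l2norm (u + v) <= l2norm u + l2norm v.
Proof.
rewrite /l2norm -rmorphD lecR -ler_sqr ?nnegrE ?addr_ge0 ?sqrtr_ge0//.
rewrite sqrrD !sqr_sqrtr ?rdot_ge0// rdotDl !rdotDr (rdotC v u).
by have := rdot_CauchySchwarz u v; lra.
Qed.

Lemma l2normZ (c : R[i]) u : l2norm (c *: u) = `|c| * l2norm u.
Proof.
rewrite /l2norm rdot_scale normc_def -rmorphM sqrtrM//.
by rewrite addr_ge0// sqr_ge0.
Qed.

Lemma l2norm_eq0 u : l2norm u = 0 -> u = 0.
Proof.
move=> -[] /eqP; rewrite sqrtr_eq0 => h; apply: rdot_eq0.
by apply/eqP; rewrite eq_le h rdot_ge0.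
Qed.

HB.instance Definition _ :=
  Lmodule_isNormed.Build R[i] l2 l2norm_triangle l2normZ l2norm_eq0.

Lemma l2_normE u : `|u| = (Num.sqrt (rdot u u))%:C%C.
Proof. by []. Qed.

Lemma cReB (a b : R[i]) : Re (a - b) = Re a - Re b.
Proof. by case: a; case: b. Qed.
Lemma cImB (a b : R[i]) : Im (a - b) = Im a - Im b.
Proof. by case: a; case: b. Qed.

(** Coordinates are contractions, so a Cauchy filter converges pointwise. *)
Lemma coord_le u x :
  `|Re (val u x)| <= Num.sqrt (rdot u u) /\ `|Im (val u x)| <= Num.sqrt (rdot u u).
Proof.
have := psum_le_usum [fset x]%fset (reprod_ge0 (val u)) (bdd_reprod_l2 u u).
rewrite -/(rdot u u) /psum big_seq_fset1 /reprod -!expr2 => h.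
have := sqr_ge0 (Re (val u x)); have := sqr_ge0 (Im (val u x)) => ? ?.
by split; rewrite -sqrtr_sqr ler_wsqrtr//; lra.
Qed.

Lemma l2_cvg_coord (F : set_system l2) (p : l2 -> R) : ProperFilter F -> cauchy F ->
  (forall u v, p (u - v) = p u - p v) -> (forall u, `|p u| <= Num.sqrt (rdot u u)) ->
  cvg (p @ F).
Proof.
move=> FF /cauchyP Fc pB pN.
apply: cauchy_cvg; apply: cauchy_exP => e e0.
have [|g Fg] := Fc e%:C%C; first by rewrite ltcR.
exists (p g); change (F (p @^-1` ball (p g) e)); apply: filterS Fg => h.
rewrite /preimage -!ball_normE /= l2_normE ltcR -pB => /le_lt_trans; apply; exact: pN.
Qed.

(** The pointwise limit [f] of a Cauchy filter is also its limit in norm: if a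
    set of the filter lies in the ball of radius [e] around [g], then every
    finite partial sum of the square norm of [h - g] is at most [e ^+ 2] for [h]
    in that set, and this survives the passage to the limit in finitely many
    coordinates; hence [f - g] is square-summable of norm at most [e]. *)
Lemma l2_complete (F : set_system l2) : ProperFilter F -> cauchy F -> cvg F.
Proof.
move=> FF Fc.
have cre x : cvg ((fun g : l2 => Re (val g x)) @ F).
  by apply: l2_cvg_coord => // [u v|u]; [rewrite /= fctE cReB|have [] := coord_le u x].
have cim x : cvg ((fun g : l2 => Im (val g x)) @ F).
  by apply: l2_cvg_coord => // [u v|u]; [rewrite /= fctE cImB|have [] := coord_le u x].
pose f x : R[i] := Complex (lim ((fun g : l2 => Re (val g x)) @ F))
                    (lim ((fun g : l2 => Im (val g x)) @ F)).
have fle (e : R) (g : l2) A : 0 < e -> F (ball g e%:C%C) ->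
    psum (reprod (f - val g) (f - val g)) A <= e ^+ 2.
  move=> e0 Fg.
  have cv : (fun h : l2 => psum (reprod (val h - val g) (val h - val g)) A) @ F -->
     psum (reprod (f - val g) (f - val g)) A.
    rewrite /psum; elim: (enum_fset A) => [|x s IH].
      rewrite big_nil; under eq_fun do rewrite big_nil; exact: cvg_cst.
    rewrite big_cons; under eq_fun do rewrite big_cons.
    apply: cvgD IH; rewrite /reprod !fctE.
    have h1 : (fun h : l2 => Re (val h x - val g x)) @ F --> Re (f x - val g x).
      by under eq_fun do rewrite cReB; rewrite cReB; apply: cvgB (cre x) (cvg_cst _).
    have h2 : (fun h : l2 => Im (val h x - val g x)) @ F --> Im (f x - val g x).
      by under eq_fun do rewrite cImB; rewrite cImB; apply: cvgB (cim x) (cvg_cst _).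
    by apply: cvgD; apply: cvgM.
  rewrite -(cvg_lim _ cv)//; apply: limr_le; first by apply/cvg_ex; eexists; exact: cv.
  apply: filterS Fg => h; rewrite -ball_normE /= distrC l2_normE ltcR => gh.
  have -> : val h - val g = val (h - g) by [].
  apply: le_trans (psum_le_usum A (reprod_ge0 _) (bdd_reprod_l2 _ _)) _.
  by rewrite -/(rdot _ _) -[leLHS]sqr_sqrtr ?rdot_ge0// ler_sqr ?nnegrE ?sqrtr_ge0 ?ltW.
have fS : f \in square_summable.
  have [|g Fg] := (iffLR (cauchyP F) Fc) 1%:C%C; first by rewrite ltcR.
  have -> : f = (f - val g) + val g by rewrite subrK.
  apply: rpredD; last exact: valP.
  apply/square_summableP; apply: bdd_sum_le => [x|].
    by rewrite ger0_norm ?reprod_ge0.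
  by exists (1 ^+ 2) => A; apply: fle.
apply/cvg_ex; exists (exist _ f fS : l2); apply/cvg_ballP => e.
rewrite ltcE => /andP[/eqP /= Ime e0].
have -> : e = (Re e)%:C%C by case: e Ime e0 => a b /= ->.
have r0 : 0 < Re e / 2 by rewrite divr_gt0.
have [|g Fg] := (iffLR (cauchyP F) Fc) (Re e / 2)%:C%C; first by rewrite ltcR.
apply: filterS (Fg) => h; rewrite -!ball_normE /= => gh.
rewrite -(subrKA g); apply: le_lt_trans (ler_normD _ _) _.
rewrite [Re e]splitr [in ltRHS]rmorphD ler_ltD// l2_normE lecR.
rewrite -[leRHS]ger0_norm ?(ltW r0)// -sqrtr_sqr; apply: ler_wsqrtr.
by apply: usum_le; [exact: bdd_reprod_l2|move=> A; exact: fle].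
Qed.

HB.instance Definition _ := Uniform_isComplete.Build l2 l2_complete.

Lemma l2_dotE : hilbert_dot (hdot : {dot l2 for Num.conj}).
Proof. by move=> v; rewrite l2_normE -rmorphXn sqr_sqrtr ?rdot_ge0//= hdotE. Qed.

End SquareSummable.

(** * Left regular representation and expansion *)

Section Translate.
Variables (R : realType) (X : choiceType).
Implicit Types (u v : l2 R X) (s : sym X) (A : {fset X}).

Lemma translate_subproof s u : (val u \o sym_inv s) \in @square_summable R X.
Proof.
apply/square_summableP.
exact: (bdd_sum_reindex (can_inj (sym_invK s)) (bdd_reprod_l2 u u)).
Qed.

Definition translate s u : l2 R X :=
  exist (fun f => f \in @square_summable R X) _ (translate_subproof s u).

Lemma translate_linear s : linear (translate s).
Proof. by move=> c u v; apply: val_inj. Qed.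

HB.instance Definition _ s := GRing.isLinear.Build R[i] (l2 R X) (l2 R X) _
  (translate s) (translate_linear s).

Lemma rdot_translate s u v : rdot (translate s u) (translate s v) = rdot u v.
Proof.
exact: (usum_reindex (sym_invK s) (sym_funK s) (bdd_reprod_l2 u v)).
Qed.

Lemma hdot_translate s u v : hdot (translate s u) (translate s v) = hdot u v.
Proof. by rewrite /hdot -linearZ /= !rdot_translate. Qed.

Lemma indic_subproof A : (fun x : X => (x \in A)%:R : R[i]) \in @square_summable R X.
Proof.
apply/square_summableP; apply: (@bdd_sum_finite _ _ _ A) => x /negbTE xA.
by rewrite /reprod xA /= mul0r addr0.
Qed.

Definition indic A : l2 R X :=
  exist (fun f => f \in @square_summable R X) _ (indic_subproof A).

Lemma translate_indic s A : translate s (indic A) = indic (s @` A)%fset.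
Proof.
apply: val_inj; apply/funext => x /=; congr (nat_of_bool _)%:R.
apply/idP/imfsetP => [xA|[y /= yA ->]]; last by rewrite sym_funK.
by exists (sym_inv s x); rewrite ?sym_invK.
Qed.

Lemma rdot_indic A B : rdot (indic A) (indic B) = #|` (A `&` B)%fset|%:R.
Proof.
rewrite /rdot (@usum_finite _ _ _ (A `&` B)%fset) => [|x].
  rewrite /psum (eq_big_seq (fun=> 1)) => [|x].
    by rewrite big_const_seq iter_addr_0 count_predT.
  by rewrite inE /reprod /= => /andP[-> ->] /=; rewrite mul0r mulr1 addr0.
rewrite inE negb_and /reprod /= => /orP[]/negbTE->/=; first by rewrite !mul0r addr0.
by rewrite !mulr0 addr0.
Qed.

(** Both sides count the symmetric difference of [A] and its translate, whose two
    halves have the same size. *)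
Lemma rdot_indic_translate s A :
  rdot (translate s (indic A) - indic A) (translate s (indic A) - indic A)
    = 2 * #|` ((s @` A) `\` A)%fset|%:R.
Proof.
have si := can_inj (sym_funK s).
have e : #|` A|%:R = #|` ((s @` A) `&` A)%fset|%:R + #|` ((s @` A) `\` A)%fset|%:R :> R.
  by rewrite -natrD cardfsID card_imfset.
rewrite translate_indic rdotDr rdotNr !(rdotC (_ - _)) !rdotDr !rdotNr.
by rewrite !rdot_indic !fsetIid (fsetIC A) card_imfset // e; ring.
Qed.

End Translate.

Section Expansion.
Variables (R : realType) (K H : groupType) (psi : {multiplicative K -> H}).
Hypothesis infinite_image : infinite_set (range psi).

Definition act (k : K) : sym H := left_translation (psi k).

Definition regrep (k : K) : {linear l2 R H -> l2 R H} := translate (act k).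

Lemma regrep_unitary : unitary_rep (@hdot R H) regrep.
Proof.
split.
- move=> v; apply: val_inj; apply/funext => x /=.
  by rewrite multiplicative1 invg1 mul1g.
- move=> g h v; apply: val_inj; apply/funext => x /=.
  by rewrite gmulfM invgM mulgA.
- by move=> g u v; exact: hdot_translate.
Qed.

(** An invariant function is constant on the orbits, which are infinite, so a
    nonzero value would give unbounded partial sums. *)
Lemma regrep_invariant0 (v : l2 R H) : (forall g, regrep g v = v) -> v = 0.
Proof.
move=> vinv; apply: contrapT => /eqP v0.
have [x vx] : exists x, reprod (val v) (val v) x != 0.
  apply: contrapT => /forallNP vx; move/eqP: v0; apply; apply: rdot_eq0.
  rewrite /rdot (@usum_finite _ _ _ fset0) ?/psum ?big_seq_fset0// => x _.
  by apply/eqP; rewrite -[_ == _]negbK; apply/negP; exact: vx.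
have {}vx : 0 < reprod (val v) (val v) x by rewrite lt0r vx reprod_ge0.
have vorb k : val v (psi k * x)%g = val v x.
  by rewrite -{1}(vinv k) /= mulKg.
have [M vM] := bdd_reprod_l2 v v.
have [B BK nB] := infinite_set_fset
  (Num.bound (M / reprod (val v) (val v) x)) infinite_image.
have := vM [fset (b * x)%g | b in B]%fset.
rewrite /psum big_imfset/=; last by move=> ? ? _ _; exact: mulIg.
rewrite (eq_big_seq (fun=> reprod (val v) (val v) x)) => [|b bB]; last first.
  have [k _ <-] := BK b bB.
  by rewrite ger0_norm ?reprod_ge0// /reprod vorb.
rewrite big_const_seq iter_addr_0 count_predT leNgt => /negP; apply.
have M0 : 0 <= M by apply: le_trans (vM fset0); rewrite /psum big_seq_fset0.
rewrite -mulr_natl -ltr_pdivrMr//; apply: lt_le_trans (archi_boundP _) _.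
  exact: divr_ge0 M0 (ltW vx).
by rewrite ler_nat.
Qed.

(** A Kazhdan pair [(S, e)] forbids [e]-invariant vectors here; for the indicator
    function of [A] this says that some [s] in [S] changes it by at least
    [e ^+ 2 * #|A|] in square norm, half of which is the number of points that
    leave [A]. *)
Lemma propertyT_expansion : property_T R K -> exists (S : set K) (d : R),
  [/\ finite_set S, 0 < d & forall A : {fset H}, A != fset0 ->
   exists2 k, S k & d * #|` A|%:R <= #|` ((act k @` A) `\` A)%fset|%:R].
Proof.
move=> [S [e [finS e0 eS]]]; exists S, (e ^+ 2 / 2); split => //.
  by rewrite divr_gt0// exprn_gt0.
move=> A A0; apply: contrapT => noS.
have [|v [v0 vinv]] := eS _ (@hdot R H : {dot _ for _}) regrep (@l2_dotE R H) regrep_unitary.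
  2:{ by move/eqP: v0; apply; exact: regrep_invariant0. }
exists (indic R A); split.
  apply/eqP => iA0; have := rdot_indic R A A; rewrite fsetIid iA0 rdot0.
  by move=> /esym/eqP; rewrite pnatr_eq0 cardfs_eq0 (negbTE A0).
move=> k Sk; rewrite !l2_normE -rmorphM ltcR.
rewrite -[e]ger0_norm ?(ltW e0)// -sqrtr_sqr -sqrtrM ?sqr_ge0//.
rewrite ltNge; apply/negP => le_e; apply: noS; exists k => //.
move: le_e; rewrite ler_sqrt; last exact: rdot_ge0.
rewrite rdot_indic fsetIid /regrep rdot_indic_translate => h.
by rewrite mulrAC ler_pdivrMr// [leRHS]mulrC.
Qed.
End Expansion.

(** * Marriage theorem for infinite families of finite sets *)

Section Hall.
Local Open Scope fset_scope.
Variables X Y : choiceType.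
Implicit Types (N M : X -> {fset Y}) (A B : {fset X}).

Definition joint_nbh N A : {fset Y} := \bigcup_(a <- A) N a.

Definition Hall_condition N := forall A, (#|` A| <= #|` joint_nbh N A|)%N.

Lemma in_joint_nbh N A y :
  reflect (exists2 a, a \in A & y \in N a) (y \in joint_nbh N A).
Proof.
apply: (iffP (bigfcupP _ _ _ _)) => [[a /andP[aA _] yN]|[a aA yN]]; first by exists a.
by exists a; rewrite ?aA.
Qed.

Lemma joint_nbh_ext N M A : {in A, N =1 M} -> joint_nbh N A = joint_nbh M A.
Proof. by move=> NM; apply: eq_big_seq. Qed.

(** Rado's argument.  If removing [y] and removing [y'] from [N x] both break the
    condition, at finite sets [A1] and [A2] say, then [x] belongs to both, and
    counting the neighbourhoods of [A1 `|` A2] and of [(A1 `&` A2) `\ x] against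
    those of [A1] and [A2] violates the condition for [N]. *)
Lemma Hall_shrink N x y y' : Hall_condition N -> y \in N x -> y' \in N x -> y != y' ->
  Hall_condition (fun z => if z == x then N x `\ y else N z) \/
  Hall_condition (fun z => if z == x then N x `\ y' else N z).
Proof.
move=> HN yN y'N yy'.
set N1 := fun z => _; set N2 := (X in _ \/ Hall_condition X).
apply: contrapT => /not_orP[] /existsNP[A1 /negP]; rewrite -ltnNge => lt1.
move=> /existsNP[A2 /negP]; rewrite -ltnNge => lt2.
have xA (M : X -> {fset Y}) A : (forall z, z != x -> M z = N z) ->
    (#|` joint_nbh M A| < #|` A|)%N -> x \in A.
  move=> MN ltM; apply: contraLR ltM => xA; rewrite -leqNgt.
  rewrite (_ : joint_nbh M A = joint_nbh N A) ?HN//; apply: joint_nbh_ext => z zA.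
  by apply: MN; apply: contraNneq xA => <-.
have xA1 : x \in A1 by apply: xA lt1 => z /negbTE zx; rewrite /N1 zx.
have xA2 : x \in A2 by apply: xA lt2 => z /negbTE zx; rewrite /N2 zx.
have sub_union : joint_nbh N (A1 `|` A2) `<=` joint_nbh N1 A1 `|` joint_nbh N2 A2.
  apply/fsubsetP => z /in_joint_nbh[a]; rewrite in_fsetU => aA za.
  rewrite in_fsetU; have [ax|ax] := eqVneq a x.
    have [zy|zy] := eqVneq z y.
      apply/orP; right; apply/in_joint_nbh; exists x => //.
      by rewrite /N2 eqxx !inE -ax za zy yy'.
    apply/orP; left; apply/in_joint_nbh; exists x => //.
    by rewrite /N1 eqxx !inE -ax za zy.
  move: aA => /orP[] aA; apply/orP; [left|right]; apply/in_joint_nbh; exists a => //.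
    by rewrite /N1 (negbTE ax).
  by rewrite /N2 (negbTE ax).
have sub_inter : joint_nbh N ((A1 `&` A2) `\ x) `<=` joint_nbh N1 A1 `&` joint_nbh N2 A2.
  apply/fsubsetP => z /in_joint_nbh[a]; rewrite !inE => /and3P[ax aA1 aA2] za.
  by apply/andP; split; apply/in_joint_nbh; exists a; rewrite // /N1 /N2 (negbTE ax).
have := fsubset_leq_card sub_union; have := fsubset_leq_card sub_inter.
have := HN (A1 `|` A2); have := HN ((A1 `&` A2) `\ x).
have := cardfsUI A1 A2; have := cardfsUI (joint_nbh N1 A1) (joint_nbh N2 A2).
have := cardfsD1 x (A1 `&` A2); rewrite inE xA1 xA2 /=.
move: lt1 lt2; lia.
Qed.

(** By Zorn's lemma there is a minimal family satisfying the condition below [N]: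
    along a chain each finite set [N x] becomes stationary, so the condition,
    which involves finitely many [x] at a time, passes to the intersection.  By
    [Hall_shrink] a minimal family consists of singletons, and the condition
    for pairs makes the resulting function injective. *)
Theorem Hall_Rado N : Hall_condition N ->
  exists2 f : X -> Y, injective f & forall x, f x \in N x.
Proof.
move=> HN; pose T := {M | Hall_condition M /\ forall x, M x `<=` N x}.
pose R (s t : T) := `[< forall x, sval t x `<=` sval s x >].
have [||||t tmax] := @Zorn T R.
- by move=> s; apply/asboolP => x; exact: fsubset_refl.
- move=> r s t /asboolP rs /asboolP st; apply/asboolP => x.
  exact: fsubset_trans (st x) (rs x).
- move=> [s Hs] [t Ht] /asboolP /= st /asboolP /= ts; apply: eq_exist => /=.
  by apply/funext => x; apply/eqP; rewrite eqEfsubset st ts.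
- move=> C Ctot; have [->|/set0P[s0 Cs0]] := eqVneq C set0.
    by exists (exist _ N (conj HN (fun x => fsubset_refl (N x)))).
  have hmin x : exists s, C s /\ forall s', C s' -> sval s x `<=` sval s' x.
    have [n [[s Cs sn] nmin]] : exists n, (exists2 s, C s & #|` sval s x| = n) /\
        forall s, C s -> (n <= #|` sval s x|)%N.
      have ex : exists n, `[< exists2 s, C s & #|` sval s x| = n >].
        by exists #|` sval s0 x|; apply/asboolP; exists s0.
      exists (ex_minn ex); case: ex_minnP => n /asboolP Pn nmin; split => // s Cs.
      by apply: nmin; apply/asboolP; exists s.
    exists s; split => // s' Cs'.
    have [/asboolP ss'|/asboolP //] := Ctot _ _ Cs Cs'.
    suff -> : sval s' x = sval s x by exact: fsubset_refl.
    by apply/eqP; rewrite eqEfcard ss' sn nmin.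
  have [m mP] := choice hmin.
  pose M x := sval (m x) x.
  have MC A : exists2 s, C s & {in A, forall x, sval s x = M x}.
    suff : exists2 s, C s & {in enum_fset A, forall x, sval s x = M x} by [].
    elim: (enum_fset A) => [|x r [s Cs sM]]; first by exists s0.
    have [Cm mx] := mP x.
    have [/asboolP sm|/asboolP ms] := Ctot _ _ Cs Cm.
      exists (m x) => // z; rewrite inE => /orP[/eqP -> //|zr].
      apply/eqP; rewrite eqEfsubset (proj2 (mP z) _ Cm) andbT.
      by rewrite -(sM z zr) sm.
    exists s => // z; rewrite inE => /orP[/eqP ->|/sM //].
    by apply/eqP; rewrite eqEfsubset ms mx.
  have HM : Hall_condition M.
    move=> A; have [s Cs sM] := MC A.
    by rewrite -(joint_nbh_ext sM); exact: (proj1 (svalP s)).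
  have MN x : M x `<=` N x by exact: (proj2 (svalP (m x))).
  exists (exist _ M (conj HM MN)) => s Cs; apply/asboolP => x /=.
  exact: (proj2 (mP x)).
- have [Ht tN] := svalP t.
  have ne x : exists y, y \in sval t x.
    apply/fset0Pn; apply: contraTneq (Ht [fset x]) => tx.
    by rewrite /joint_nbh big_seq_fset1 tx cardfs0 cardfs1.
  have [f fP] := choice ne.
  have uni x y : y \in sval t x -> y = f x.
    move=> ytx; apply/eqP; apply: contrapT => /negP yf.
    have shrink z : z \in sval t x ->
        ~ Hall_condition (fun w => if w == x then sval t x `\ z else sval t w).
      move=> ztx Hz; set t' := (X in Hall_condition X) in Hz.
      have t't w : t' w `<=` sval t w.
        by rewrite /t'; case: eqP => [->|_]; [exact: fsubsetDl|exact: fsubset_refl].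
      have t'N w : t' w `<=` N w := fsubset_trans (t't w) (tN w).
      suff /(congr1 (fun s : T => z \in sval s x)) : exist _ t' (conj Hz t'N) = t.
        by rewrite /= /t' eqxx !inE eqxx ztx.
      by apply: tmax; exact/asboolP.
    by have [/shrink|/shrink] := Hall_shrink Ht ytx (fP x) yf; apply.
  exists f => [x x' ff|x]; last exact: fsubsetP (tN x) _ (fP x).
    apply/eqP; apply: contraTT (Ht [fset x; x']) => xx'.
    rewrite -ltnNge cardfs2 xx'.
    suff : joint_nbh (sval t) [fset x; x'] `<=` [fset f x].
      by move/fsubset_leq_card; rewrite cardfs1.
    apply/fsubsetP => y /in_joint_nbh[z]; rewrite !inE.
    by move=> /orP[]/eqP -> /uni ->; rewrite ?ff.
Qed.

End Hall.

(** * Invariant means and property (T) *)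

Section Growth.
Local Open Scope fset_scope.
Variables (K H : groupType) (psi : {multiplicative K -> H}).
Implicit Types (U V : {fset K}) (A : {fset H}).

Definition translates U A : {fset H} := [fset (psi k * a)%g | k in U, a in A].

Lemma translates_prod U V A :
  translates [fset (k * l)%g | k in U, l in V] A = translates U (translates V A).
Proof.
apply/fsetP => x; apply/imfset2P/imfset2P => /=.
  move=> [_ /imfset2P[k kU [l lV ->]] [a aA ->]].
  exists k => //; exists (psi l * a)%g; last by rewrite gmulfM mulgA.
  by apply/imfset2P; exists l => //; exists a.
move=> [k kU [_ /imfset2P[l lV [a aA ->]] ->]].
exists (k * l)%g; first by apply/imfset2P; exists k => //; exists l.
by exists a => //; rewrite gmulfM mulgA.
Qed.

(** If [S] expands every finite set by the factor [1 + d], then the products of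
    [n] elements of [1 |` S] expand it by [(1 + d) ^+ n], which exceeds [2] for
    large [n]. *)
Lemma expansion_doubling (R : realType) (S : set K) (d : R) : finite_set S -> 0 < d ->
  (forall A, A != fset0 -> exists2 k, S k &
    d * #|` A|%:R <= #|` ((act psi k @` A) `\` A)%fset|%:R) ->
  exists U, forall A, (#|` A|.*2 <= #|` translates U A|)%N.
Proof.
move=> /finite_fsetP[F FS] d0 exp.
have psi1 := multiplicative1 psi.
pose U := 1%g |` F.
have step A : (1 + d) * #|` A|%:R <= #|` translates U A|%:R :> R.
  have [->|A0] := eqVneq A fset0; first by rewrite cardfs0 mulr0 ler0n.
  have [k Sk /le_trans h] := exp A A0.
  rewrite mulrDl mul1r addrC -lerBrDr; apply: h.
  rewrite lerBrDr -natrD ler_nat.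
  suff : A `|` ((act psi k @` A) `\` A) `<=` translates U A.
    move/fsubset_leq_card; apply: leq_trans; rewrite cardfsU.
    have -> : A `&` ((act psi k @` A) `\` A) = fset0.
      by apply/fsetP => x; rewrite !inE; case: (x \in A).
    by rewrite cardfs0 subn0 addnC.
  apply/fsubsetP => x; rewrite !inE => /orP[xA|/andP[_ /imfsetP[a /= aA ->]]].
    by apply/imfset2P; exists 1%g; rewrite ?inE ?eqxx//; exists x; rewrite ?psi1 ?mul1g.
  apply/imfset2P; exists k; last by exists a.
  by rewrite /= inE; apply/orP; right; move: Sk; rewrite FS.
have grow n : exists V, forall A, (1 + d) ^+ n * #|` A|%:R <= #|` translates V A|%:R :> R.
  elim: n => [|n [V VA]].
    exists [fset 1%g] => A; rewrite expr0 mul1r ler_nat fsubset_leq_card//.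
    apply/fsubsetP => x xA; apply/imfset2P; exists 1%g; rewrite ?inE//.
    by exists x; rewrite ?psi1 ?mul1g.
  exists [fset (k * l)%g | k in U, l in V] => A.
  rewrite translates_prod exprS -mulrA; apply: le_trans (step _).
  by rewrite ler_wpM2l ?VA// addr_ge0 ?ltW.
have bernoulli n : (1 + d *+ n <= (1 + d) ^+ n)%R.
  elim: n => [|n IH]; first by rewrite mulr0n addr0 expr0.
  rewrite exprS; apply: le_trans (ler_wpM2l _ IH); last by rewrite addr_ge0 ?ltW.
  rewrite mulrDl mul1r mulrDr mulr1 mulrSr -!addrA lerD2l lerD2l lerDl.
  by rewrite mulr_ge0 ?mulrn_wge0 ?ltW.
have [V VA] := grow (Num.bound d^-1).
exists V => A; rewrite -(ler_nat R) -muln2 natrM mulrC.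
apply: le_trans (VA A); rewrite ler_wpM2r//.
apply: le_trans (bernoulli _); rewrite (_ : 2%:R = 1 + 1 :> R)%R // lerD2l.
rewrite -[leRHS]mulr_natr -ler_pdivrMl// mulr1.
by apply/ltW/archi_boundP; rewrite invr_ge0 ltW.
Qed.

End Growth.

Section Mean.
Variables (R : realType) (K H : groupType) (psi : {multiplicative K -> H}).
Variable mu : set H -> R.
Hypothesis mu1 : mu [set: H] = 1.
Hypothesis mu_ge0 : forall A, 0 <= mu A.
Hypothesis muU : forall A B, A `&` B = set0 -> mu (A `|` B) = mu A + mu B.
Hypothesis mu_inv : forall g A, mu [set (g * x)%g | x in A] = mu A.

(** A map which is injective and acts by finitely many translations preserves the
    mean: the pieces on which one translation acts are disjoint, and so are their
    images. *)
Lemma mean_piecewise (c : H -> K) (r : seq K) : uniq r ->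
  injective (fun x => psi (c x) * x)%g ->
  mu [set (psi (c x) * x)%g | x in [set x | c x \in r]] = mu [set x | c x \in r].
Proof.
move=> + ci; elim: r => [_|k r IH /= /andP[kr ur]].
  have -> : [set x | c x \in [::]] = set0 by apply/seteqP; split.
  by rewrite image_set0.
have -> : [set x | c x \in k :: r] = [set x | c x = k] `|` [set x | c x \in r].
  apply/seteqP; split => x /=; rewrite inE; first by case/orP=> [/eqP|]; [left|right].
  by case=> [->|->]; rewrite ?eqxx ?orbT.
have disj : [set x | c x = k] `&` [set x | c x \in r] = set0.
  by apply/seteqP; split => // x /= [-> kr']; rewrite kr' in kr.
rewrite image_setU !muU// ?IH//.
  congr (_ + _); rewrite -[RHS](mu_inv (psi k)); congr mu.
  by apply/seteqP; split => _ [x /= ck <-]; exists x => //=; rewrite ck.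
apply/seteqP; split => // _ [[x /= xk <-] [y /= yr /ci yx]].
by move: kr; rewrite -xk -yx yr.
Qed.

(** Doubling is the marriage condition for two copies of [H], where both copies
    of [x] may be sent to any of the points [psi k * x] with [k] in [U].  The
    resulting matching embeds two disjoint copies of [H] into [H] by piecewise
    translations. *)
Lemma mean_no_doubling (U : {fset K}) :
  ~ (forall A : {fset H}, (#|` A|.*2 <= #|` translates psi U A|)%N).
Proof.
move=> dbl.
pose N (p : H * bool) := translates psi U [fset p.1]%fset.
have HN : Hall_condition N.
  move=> A; pose B := [fset p.1 | p in A]%fset.
  apply: (@leq_trans #|` B|.*2).
    have le_copy (b : bool) : (#|` [fset (x, b) | x in B]%fset| <= #|` B|)%N.
      by rewrite card_imfset => [|x y []].
    have := leq_add (le_copy true) (le_copy false); rewrite addnn; apply: leq_trans.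
    rewrite -cardfsUI; apply: leq_trans (leq_addr _ _).
    apply/fsubset_leq_card/fsubsetP => -[x b] xbA; rewrite inE.
    have xB : x \in B by apply/imfsetP; exists (x, b).
    by case: b {xbA}; apply/orP; [left|right]; apply/imfsetP; exists x.
  apply: leq_trans (dbl B) (fsubset_leq_card _); apply/fsubsetP => y.
  move=> /imfset2P[k kU [_ /imfsetP[p pA ->] ->]]; apply/in_joint_nbh; exists p => //.
  by apply/imfset2P; exists k => //; exists p.1; rewrite ?inE.
have [f finj fN] := Hall_Rado HN.
have exk p : exists k, k \in U /\ f p = (psi k * p.1)%g.
  have /imfset2P[k kU [a]] := fN p.
  by rewrite inE => /eqP -> ->; exists k.
have [c cP] := choice exk.
have img b : mu (range (fun x => f (x, b))) = 1.
  rewrite -mu1 (_ : [set: H] = [set x | c (x, b) \in enum_fset U]); last first.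
    by apply/seteqP; split => // x _; exact: (cP (x, b)).1.
  rewrite -(@mean_piecewise (fun x => c (x, b))) ?fset_uniq//.
    by congr (mu [set _ | _ in _]); apply/funext => x; rewrite (cP (x, b)).2.
  move=> x y /= xy; have /finj [] // : f (x, b) = f (y, b).
  by rewrite !(cP _).2.
have : mu (range (fun x => f (x, true)) `|` range (fun x => f (x, false))) = 2.
  rewrite muU ?img//; apply/seteqP; split => // y [[x _ <-] [x' _ /finj]].
  by case.
set D := _ `|` _ => D2; have := @muU D (~` D).
by rewrite setICr setUCr mu1 D2 => /(_ erefl); have := mu_ge0 (~` D); lra.
Qed.

End Mean.

(** Property (T) and amenability meet on [l2 R H]: infinite image would give
    expansion, hence doubling, in a group with an invariant mean. *)
Lemma propertyT_amenable_finite_range (R : realType) (K H : groupType)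
  (psi : {multiplicative K -> H}) : property_T R K -> amenable R H ->
  finite_set (range psi).
Proof.
move=> KT [mu [mu1 mu_ge0 muU mu_inv]]; apply: contrapT => psi_inf.
have [S [d [finS d0 Sd]]] := propertyT_expansion psi_inf KT.
have [U] := expansion_doubling finS d0 Sd.
exact: (mean_no_doubling mu1 mu_ge0 muU mu_inv).
Qed.

(** * Transpositions and translations in Q *)

Section GroupQElements.
Local Open Scope group_scope.

Section Transpositions.
Variable T : choiceType.
Implicit Types (x y z : T) (s : sym T).

Definition swap x y z := if z == x then y else if z == y then x else z.

Lemma swapK x y : involutive (swap x y).
Proof.
move=> z; rewrite /swap; have [->|zx] := eqVneq z x.
  by rewrite eqxx; case: eqVneq => // ->.
by have [->|zy] := eqVneq z y; rewrite ?eqxx// (negbTE zx) (negbTE zy).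
Qed.

Definition transp x y : sym T := Defs.Sym (swapK x y) (swapK x y).

(** Products in [sym T] apply their left factor first, so that conjugation by [s]
    relabels the points by [s]. *)
Lemma transp_conj s x y : s^-1 * transp x y * s = transp (s x) (s y).
Proof.
apply: sym_ext => z /=; rewrite /swap.
rewrite !(can2_eq (sym_invK s) (sym_funK s)).
by case: ifP => // _; case: ifP => // _; rewrite sym_invK.
Qed.

Lemma transp_finitary x y : finitary_sym (transp x y).
Proof.
apply: (@sub_finite_set _ _ [set x; y]); last exact: finite_set2.
move=> z /=; rewrite /swap; case: eqP => [|_]; first by left.
by case: eqP => [|_ []//]; right.
Qed.

End Transpositions.

Section GroupQ.
Variable K : groupType.
Implicit Types (k : K).

Lemma transp_inQ (x y : K) :
  transp x y \in gen_subgroup (@finitary_sym K `|` range (@left_translation K)).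
Proof. by rewrite inE; apply: sub_gen_subgroup; left; exact: transp_finitary. Qed.

Lemma left_translation_inQ k :
  left_translation k \in gen_subgroup (@finitary_sym K `|` range (@left_translation K)).
Proof. by rewrite inE; apply: sub_gen_subgroup; right; exists k. Qed.

Definition transpQ (x y : K) : groupQ K :=
  exist (fun s => s \in gen_subgroup _) _ (transp_inQ x y).
Definition translQ k : groupQ K :=
  exist (fun s => s \in gen_subgroup _) _ (left_translation_inQ k).

(** The order is reversed because products in [sym K] apply their left factor
    first. *)
Lemma translQM k l : translQ (k * l) = translQ l * translQ k.
Proof. by apply: val_inj; apply: sym_ext => x /=; rewrite mulgA. Qed.

Lemma transpQ_conj (q : groupQ K) x y :
  q^-1 * transpQ x y * q = transpQ (val q x) (val q y).
Proof. by apply: val_inj; rewrite /= -transp_conj. Qed.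

Lemma transpQC x y : transpQ x y = transpQ y x :> groupQ K.
Proof.
apply: val_inj; apply: sym_ext => z /=; rewrite /swap.
by have [->|] := eqVneq z x; case: eqVneq => // ->.
Qed.

Lemma transpQxx x : transpQ x x = 1 :> groupQ K.
Proof.
by apply: val_inj; apply: sym_ext => z /=; rewrite /swap; case: eqVneq.
Qed.

End GroupQ.

End GroupQElements.

(** * Q is finitely generated *)

Section FinitelyGenerated.
Local Open Scope group_scope.

Section FG.
Variable K : groupType.
Implicit Types (k l : K) (q : groupQ K).
Variable S : set K.
Hypothesis genS : gen_subgroup S = [set: K].

(** Conjugating [transpQ 1 s] by the translations gives the transpositions along
    all edges labelled by [s] of the Cayley graph. *)
Definition gensQ : set (groupQ K) := (@translQ K @` S) `|` [set transpQ 1 s | s in S].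
Local Notation M := (gen_subgroup gensQ).

Lemma gens_transl k : M (translQ k).
Proof.
have : gen_subgroup S k by rewrite genS.
move: k; apply: gen_subgroup_ind => [s Ss||x y Mx My].
- by apply: sub_gen_subgroup; left; exists s.
- rewrite (_ : translQ 1 = 1); first exact: gen_subgroup1.
  by apply: val_inj; apply: sym_ext => z /=; rewrite mul1g.
- rewrite translQM (_ : translQ y^-1 = (translQ y)^-1).
    by apply: gen_subgroupM => //; exact: gen_subgroupV.
  by apply: val_inj; apply: sym_ext => z.
Qed.

Lemma gens_transp_trans x y z : M (transpQ x y) -> M (transpQ y z) -> M (transpQ x z).
Proof.
move=> Mxy Myz; have [->//|xy] := eqVneq x y.
have [->|xz] := eqVneq x z; first by rewrite transpQxx; exact: gen_subgroup1.
have -> : transpQ x z = (transpQ y z)^-1 * transpQ x y * transpQ y z.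
  by rewrite transpQ_conj /= /swap (negbTE xy) (negbTE xz) eqxx.
by apply: gen_subgroupM => //; apply: gen_subgroupM => //; exact: gen_subgroupV.
Qed.

(** The set of [k] such that [transpQ l (l * k)] is generated for every [l]
    contains [S] and is a subgroup, by composing transpositions along a path. *)
Lemma gens_transp x y : M (transpQ x y).
Proof.
have Mk k l : M (transpQ l (l * k)).
  suff h : gen_subgroup S `<=` (fun k => forall l, M (transpQ l (l * k))).
    by apply: h; rewrite genS.
  apply: gen_subgroup_ind => [s Ss {}l||a b Ma Mb {}l].
  - have := transpQ_conj (translQ l) 1 s; rewrite /= mulg1 => <-.
    apply: gen_subgroupM (gens_transl l); apply: gen_subgroupM.
      exact: gen_subgroupV (gens_transl l).
    by apply: sub_gen_subgroup; right; exists s.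
  - by move=> {}l; rewrite mulg1 transpQxx; exact: gen_subgroup1.
  - apply: gens_transp_trans (Ma l) _; rewrite transpQC.
    by have := Mb (l * (a * b^-1)); rewrite -(mulgA l) mulgVK.
by have := Mk (x^-1 * y) x; rewrite mulKVg.
Qed.

(** A point [x] of the support becomes fixed after composition with the
    transposition of [q x] and [x], and the points fixed by [q] remain fixed; so
    one can induct on a list that contains the support. *)
Lemma gens_finitary q : finitary_sym (val q) -> M q.
Proof.
move=> /finite_seqP[r qr].
have {}qr x : x \notin r -> val q x = x.
  move=> xr; apply: contrapT => qx.
  have : [set x | val q x <> x] x by []; rewrite qr /= => xr'.
  by rewrite xr' in xr.
elim: r q qr => [|x r IH] q qr.
  rewrite (_ : q = 1); first exact: gen_subgroup1.
  by apply: val_inj; apply: sym_ext => x; rewrite qr.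
rewrite -[q](mulgK (transpQ (val q x) x)).
apply: gen_subgroupF (gens_transp _ _); apply: IH => z zr.
change (swap (val q x) x (val q z) = z); rewrite /swap.
have [->|zx] := eqVneq z x; first by rewrite eqxx.
rewrite qr ?inE ?negb_or ?zx// (negbTE zx); case: eqVneq => // zq.
have := sym_funK (val q) z; rewrite qr ?inE ?negb_or ?zx// zq sym_funK => zx'.
by rewrite zq -zx' eqxx in zx.
Qed.

Lemma gensQ_full : M = [set: groupQ K].
Proof.
apply/seteqP; split => // q _.
have : gen_subgroup (@finitary_sym K `|` range (@left_translation K)) (val q).
  by have := valP q; rewrite inE.
suff h : gen_subgroup (@finitary_sym K `|` range (@left_translation K)) `<=`
    (fun s => exists2 q, M q & val q = s).
  by move=> /h[q' Mq' /val_inj <-].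
apply: gen_subgroup_ind => [s [sfin|[k _ <-]]||_ _ [a Ma <-] [b Mb <-]].
- have sQ : s \in gen_subgroup (@finitary_sym K `|` range (@left_translation K)).
    by rewrite inE; apply: sub_gen_subgroup; left.
  by exists (exist (fun s => s \in gen_subgroup _) s sQ) => //; exact: gens_finitary.
- by exists (translQ k) => //; exact: gens_transl.
- by exists 1 => //; exact: gen_subgroup1.
- by exists (a * b^-1) => //; exact: gen_subgroupF.
Qed.
End FG.

Lemma groupQ_finitely_generated (K : groupType) :
  finitely_generated K -> finitely_generated (groupQ K).
Proof.
move=> [S [finS genS]]; exists (gensQ S); split; last exact: gensQ_full.
by rewrite finite_setU; split; exact: finite_image.
Qed.

End FinitelyGenerated.

(** * Q is not residually amenable *)

Section ResidualAmenability.
Local Open Scope group_scope.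

Section NotResiduallyAmenable.
Variable K : groupType.

(** The fibres of [psi] are cosets of its kernel, and finitely many of them
    cover [K]. *)
Lemma infinite_kernel (H : groupType) (psi : {multiplicative K -> H}) :
  infinite_set [set: K] -> finite_set (range psi) -> infinite_set [set k | psi k = 1].
Proof.
move=> Kinf ran_fin ker_fin; apply: Kinf.
rewrite (_ : [set: K] = \bigcup_(h in range psi) [set k | psi k = h]); last first.
  by apply/seteqP; split => // k _; exists (psi k) => //; exists k.
apply: bigcup_finite => // _ [k _ <-].
apply: (@sub_finite_set _ _ [set k * l | l in [set k | psi k = 1]]); last exact: finite_image.
move=> l /= lk; exists (k^-1 * l); last by rewrite mulKVg.
by apply: (mulgI (psi k)); rewrite -gmulfM mulKVg mulg1.
Qed.

(** Conjugation by [translQ m], which [phi] kills, identifies the images of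
    [(x y)] and [(mx my)].  Conjugation by [(y z)] carries the former to [(x z)]
    and leaves the latter alone, as [mx] and [my] differ from [y] and [z]. *)
Lemma transpQ_identified (H : groupType) (phi : {multiplicative groupQ K -> H}) m x y z :
  phi (translQ m) = 1 ->
  m * x != y -> m * x != z -> m * y != y -> m * y != z -> x != y -> x != z ->
  phi (transpQ x y) = phi (transpQ x z).
Proof.
move=> phim mxy mxz myy myz xy xz.
have e1 : phi (transpQ (m * x) (m * y)) = phi (transpQ x y).
  by rewrite -(transpQ_conj (translQ m)) multiplicativeJ phim invg1 mul1g mulg1.
have fix_swap a : a != y -> a != z -> swap y z a = a.
  by rewrite /swap => /negbTE -> /negbTE ->.
have xzE : transpQ x z = (transpQ y z)^-1 * transpQ x y * transpQ y z.
  by rewrite transpQ_conj /= fix_swap// /swap eqxx.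
have mE : transpQ (m * x) (m * y) =
    (transpQ y z)^-1 * transpQ (m * x) (m * y) * transpQ y z.
  by rewrite transpQ_conj /= !fix_swap.
by rewrite xzE multiplicativeJ -e1 -multiplicativeJ -mE.
Qed.

Lemma groupQ_not_residually_amenable (R : realType) :
  infinite_set [set: K] -> property_T R K -> ~ residually_amenable R (groupQ K).
Proof.
move=> Kinf KT RA.
have [B _ B3] := infinite_set_fset 3 Kinf.
have [x [y [z [xy xz yz]]]] : exists x y z : K, [/\ x != y, x != z & y != z].
  move: (fset_uniq B) B3; case: (enum_fset B) => [|x [|y [|z s]]] //=.
  rewrite !inE !negb_or => /and4P[/and3P[xy xz _] /andP[yz _] _ _] _.
  by exists x, y, z.
pose g := transpQ x y * transpQ x z.
have g1 : g <> 1.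
  move=> /(congr1 (fun q : groupQ K => val q y)) /=; rewrite /swap.
  rewrite (eq_sym y x) (negbTE xy) !eqxx.
  by move/eqP; rewrite eq_sym (negbTE yz).
have [H [phi [H_amenable _ phig]]] := RA g g1.
(* The inverse compensates for [translQ] reversing products. *)
have psiM : {morph (fun k => phi (translQ k^-1)) : k l / k * l}.
  by move=> k l; rewrite invgM translQM gmulfM.
pose psi : {multiplicative K -> H} :=
  HB.pack (fun k => phi (translQ k^-1)) (isMultiplicative.Build _ _ _ psiM).
have psi_fin := propertyT_amenable_finite_range psi KT H_amenable.
pose F := [set y * x^-1; z * x^-1; y * y^-1; z * y^-1].
have [m [phim mF]] : exists m, phi (translQ m) = 1 /\ ~ F m.
  apply: contrapT => /forallNP nom; apply: (infinite_kernel Kinf psi_fin).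
  apply: (@sub_finite_set _ _ [set k^-1 | k in F]); last first.
    by apply: finite_image; rewrite /F !finite_setU; do !split; exact: finite_set1.
  move=> k /= psik; exists k^-1; last exact: invgK.
  by apply: contrapT => nF; apply: (nom k^-1).
have neq a b : ~ m = b * a^-1 -> m * a != b.
  by move=> mab; apply/eqP => ab; apply: mab; rewrite -ab mulgK.
have phixy : phi (transpQ x y) = phi (transpQ x z).
  by apply: (transpQ_identified phim) => //; apply: neq => mE;
    apply: mF; rewrite /F mE /=; auto.
apply: phig; rewrite /g gmulfM -phixy -gmulfM -(multiplicative1 phi).
congr (phi _); apply: val_inj; apply: sym_ext => w /=; exact: swapK.
Qed.

End NotResiduallyAmenable.

End ResidualAmenability.

(** * Q is locally embeddable into finite groups *)

Section Soficity.
Local Open Scope group_scope.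

Lemma residually_finite_separate (K : groupType) (r : seq K) : residually_finite K ->
  exists (H : finGroupType) (pi : {multiplicative K -> H}),
    {in r, forall g, pi g = 1 -> g = 1}.
Proof.
move=> rf; elim: r => [|g r [H [pi piP]]].
  (* Any finite group would do for the empty list. *)
  have oneM : {morph (fun _ : K => 1 : {perm bool}) : x y / x * y}.
    by move=> x y; rewrite mulg1.
  pose one : {multiplicative K -> {perm bool}} :=
    HB.pack (fun _ : K => 1 : {perm bool}) (isMultiplicative.Build _ _ _ oneM).
  by exists {perm bool}, one.
have [->|g1] := pselect (g = 1).
  exists H, pi => x; rewrite inE => /orP[/eqP -> //|]; exact: piP.
have [H' [pi' pi'g]] := rf g g1.
have pairM : {morph (fun x => (pi' x, pi x)) : x y / x * y}.
  by move=> x y; rewrite !gmulfM.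
pose pair : {multiplicative K -> (H' * H)%type} :=
  HB.pack (fun x => (pi' x, pi x)) (isMultiplicative.Build _ _ _ pairM).
exists (H' * H)%type, pair => x.
by rewrite inE => /orP[/eqP ->|/piP xP] [] //.
Qed.

(** Separating the quotients of pairs of points from 1 makes [pi] injective on
    them. *)
Lemma residually_finite_injective (K : groupType) (r : seq K) : residually_finite K ->
  exists (H : finGroupType) (pi : {multiplicative K -> H}), {in r &, injective pi}.
Proof.
move=> /(residually_finite_separate [seq x * y^-1 | x <- r, y <- r])[H [pi piP]].
exists H, pi => x y xr yr pixy; apply: (mulIg y^-1); rewrite mulgV; apply: piP.
  by apply/allpairsP; exists (x, y).
by rewrite gmulfM pixy -gmulfM mulgV multiplicative1.
Qed.

Section AlmostTranslations.
Variable K : groupType.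
Hypothesis K_infinite : infinite_set [set: K].
Implicit Types (q e f : groupQ K) (k : K).

Lemma groupQ_almost_translation q :
  exists k, finite_set [set x | val q x <> k * x].
Proof.
have : gen_subgroup (@finitary_sym K `|` range (@left_translation K)) (val q).
  by have := valP q; rewrite inE.
move: (val q); apply: gen_subgroup_ind => [s [sfin|[k _ <-]]||s t [k sk] [l tl]].
- by exists 1; apply: sub_finite_set sfin => x /=; rewrite mul1g.
- by exists k; apply: (@sub_finite_set _ _ set0) => // x /=.
- by exists 1; apply: (@sub_finite_set _ _ set0) => // x /=; rewrite mul1g.
- exists (l^-1 * k); pose g y := k^-1 * (l * y).
  apply: (@sub_finite_set _ _ ([set x | s x <> k * x] `|`
    g @` [set x | t x <> l * x])).
    move=> x /= sx; have [skx|] := pselect (s x = k * x); last by left.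
    right; exists (l^-1 * (k * x)); last by rewrite /g mulVKg mulKg.
    move=> tx; apply: sx; rewrite skx -mulgA -[RHS](sym_funK t) tx.
    by rewrite mulVKg.
  by rewrite finite_setU; split => //; exact: finite_image.
Qed.

(** Two distinct left translations differ everywhere, and [K] is infinite. *)
Lemma almost_translation_unique (s : K -> K) k l :
  finite_set [set x | s x <> k * x] -> finite_set [set x | s x <> l * x] -> k = l.
Proof.
move=> sk sl; apply: contrapT => kl; apply: K_infinite.
apply: (@sub_finite_set _ _ ([set x | s x <> k * x] `|` [set x | s x <> l * x])).
  move=> x _ /=; have [skx|] := pselect (s x = k * x); last by left.
  by right => slx; apply: kl; apply: (mulIg x); rewrite -skx.
by rewrite finite_setU.
Qed.

Section Model.
Variables (D : groupQ K -> seq K) (tpart : groupQ K -> K).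
Hypothesis tpartP : forall q x, x \notin D q -> val q x = tpart q * x.

Lemma tpart_finite q : finite_set [set x | val q x <> tpart q * x].
Proof.
apply: (@sub_finite_set _ _ [set` D q]); last exact: finite_seq.
by move=> x /= qx; apply: contrapT => /negP xD; apply: qx; exact: tpartP.
Qed.

Lemma tpartM e f : tpart (e * f) = tpart f * tpart e.
Proof.
apply: (@almost_translation_unique (val (e * f))) (tpart_finite _) _.
apply: (@sub_finite_set _ _ ([set x | val e x <> tpart e * x] `|`
    ( *%g (tpart e)^-1) @` [set x | val f x <> tpart f * x])).
  move=> x /= efx; have [ex|] := pselect (val e x = tpart e * x); last by left.
  right; exists (val e x); last by rewrite ex mulKg.
  by move=> fex; apply: efx; rewrite fex ex mulgA.
by rewrite finite_setU; split; [|apply: finite_image]; exact: tpart_finite.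
Qed.

Lemma tpart1 : tpart 1 = 1.
Proof.
apply: (@almost_translation_unique id) (tpart_finite 1) _.
by apply: (@sub_finite_set _ _ set0) => // x /=; rewrite mul1g.
Qed.

Variables (H : finGroupType) (pi : {multiplicative K -> H}).

(** Here [D q] is a finite set outside which [q] is the translation by [tpart q].
    On the image of [D q] the permutation [q] is transported along [pi]; elsewhere
    the image of its translation part acts.  If [pi] is injective on [D q], the
    choice of the preimage [b] is forced. *)
Definition finite_model q (h : H) : H :=
  if [seq b <- D q | pi b == h] is b :: _ then pi (val q b) else pi (tpart q) * h.

Lemma finite_model_out q h :
  (forall b, b \in D q -> pi b != h) -> finite_model q h = pi (tpart q) * h.
Proof.
move=> hD; rewrite /finite_model; case E : [seq _ <- _ | _] => [//|b s].
have : b \in [seq b <- D q | pi b == h] by rewrite E inE eqxx.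
by rewrite mem_filter => /andP[+ /hD] => ->.
Qed.

Lemma finite_model1 h : finite_model 1 h = h.
Proof.
rewrite /finite_model; case E : [seq _ <- _ | _] => [|b s].
  by rewrite tpart1 multiplicative1 mul1g.
have : b \in [seq b <- D 1 | pi b == h] by rewrite E inE eqxx.
by rewrite mem_filter => /andP[/eqP].
Qed.

Variable B : seq K.
Hypothesis piB : {in B &, injective pi}.

(** On a set where [pi] is injective, [pi] intertwines [q] and its model: outside
    [D q] both are given by the translation part. *)
Lemma finite_model_in q x : {subset D q <= B} -> x \in B ->
  finite_model q (pi x) = pi (val q x).
Proof.
move=> DB xB; rewrite /finite_model; case E : [seq _ <- _ | _] => [|b s].
  rewrite tpartP ?gmulfM//; apply/negP => xD.
  have : x \in [seq b <- D q | pi b == pi x] by rewrite mem_filter eqxx.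
  by rewrite E.
have : b \in [seq b <- D q | pi b == pi x] by rewrite E inE eqxx.
by rewrite mem_filter => /andP[/eqP bx bD]; rewrite (piB _ _ bx)// DB.
Qed.

(** Preimages under [e] enter because [f] acts after [e] in [e * f]. *)
Definition exceptional e f :=
  D e ++ D (e * f) ++ [seq sym_inv (val e) d | d <- D f].

(** The images under [e] are included so that the model of [f] can be evaluated on
    [pi (val e b)] for an exceptional point [b]. *)
Definition window e f :=
  exceptional e f ++ [seq val e b | b <- exceptional e f] ++ D f.

(** On the image of the exceptional points [pi] intertwines the permutations with
    their models.  Elsewhere both models act by translation parts, provided that the
    translate of [h] by the part of [e] avoids the image of [D f]; a preimage in
    [D f] would pull back to an exceptional point above [h]. *)
Lemma finite_modelM e f : {subset window e f <= B} ->
  forall h, finite_model (e * f) h = finite_model f (finite_model e h).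
Proof.
move=> WB h; pose X := exceptional e f.
have XB : {subset X <= B} by move=> b bX; apply: WB; rewrite mem_cat bX.
have eXB b : b \in X -> val e b \in B.
  by move=> bX; apply: WB; rewrite !mem_cat (map_f (val e)) ?orbT.
have DeB : {subset D e <= B} by move=> b bD; apply: XB; rewrite mem_cat bD.
have DefB : {subset D (e * f) <= B}.
  by move=> b bD; apply: XB; rewrite !mem_cat bD orbT.
have DfB : {subset D f <= B} by move=> b bD; apply: WB; rewrite !mem_cat bD !orbT.
have [/hasP[b bX /eqP <-]|/hasPn hX] := boolP (has (fun b => pi b == h) X).
  rewrite (finite_model_in DefB (XB _ bX)) (finite_model_in DeB (XB _ bX)).
  by rewrite (finite_model_in DfB (eXB _ bX)).
rewrite finite_model_out => [|b bD]; last by apply: hX; rewrite !mem_cat bD orbT.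
rewrite [finite_model e h]finite_model_out => [|b bD]; last by apply: hX; rewrite mem_cat bD.
rewrite finite_model_out => [|d dD]; first by rewrite tpartM gmulfM mulgA.
apply/eqP => pid.
pose y := (tpart e)^-1 * d.
have piy : pi y = h by rewrite /y gmulfM multiplicativeV pid mulKg.
have [yX|yX] := boolP (y \in X); first by have := hX y yX; rewrite piy eqxx.
have yDe : y \notin D e by apply: contra yX => yD; rewrite mem_cat yD.
have ey : val e y = d by rewrite (tpartP yDe) /y mulVKg.
move/negP: yX; apply; rewrite !mem_cat; apply/orP; right; apply/orP; right.
by apply/mapP; exists d => //; rewrite -ey sym_funK.
Qed.

End Model.

(** [r'] is closed under inverses so that multiplicativity makes the models
    bijective; the points [wit q], moved by [q], keep nontrivial elements
    nontrivial in the model.  A nontrivial permutation of [H] moves every point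
    of Sym(H) under right multiplication. *)
Lemma groupQ_sofic (R : realType) : residually_finite K -> sofic R (groupQ K).
Proof.
move=> rf eps F /andP[eps0 eps1] /finite_seqP[r ->].
have [tpart tpart_fin] := choice groupQ_almost_translation.
have exD q : exists D : seq K, forall x, x \notin D -> val q x = tpart q * x.
  have /finite_seqP[D DE] := tpart_fin q; exists D => x xD; apply: contrapT => qx.
  have : [set x | val q x <> tpart q * x] x by []; rewrite DE /= => xD'.
  by rewrite xD' in xD.
have [D tpartP] := choice exD.
have exw q : exists x, q <> 1 -> val q x <> x.
  have [->|q1] := pselect (q = 1); first by exists 1 => n11; case: n11.
  apply: contrapT => /forallNP qx; apply: q1; apply: val_inj; apply: sym_ext => x.
  by apply: contrapT => qxx; apply: (qx x).
have [wit witP] := choice exw.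
pose r' := r ++ [seq q^-1 | q <- r].
pose B := flatten [seq window D e f | e <- r', f <- r'] ++
  (map wit r ++ [seq val q (wit q) | q <- r]).
have [H [pi piB]] := residually_finite_injective B rf.
have modM e f : e \in r' -> f \in r' ->
    forall h, finite_model D tpart pi (e * f) h =
      finite_model D tpart pi f (finite_model D tpart pi e h).
  move=> er fr; apply: (finite_modelM tpartP piB) => b bW; rewrite mem_cat; apply/orP; left.
  apply/flattenP; exists (window D e f) => //; apply/allpairsP.
  by exists (e, f).
have rr' q : q \in r -> q \in r' by move=> qr; rewrite mem_cat qr.
have mod_inj q : q \in r -> injective (finite_model D tpart pi q).
  move=> qr; apply: (can_inj (g := finite_model D tpart pi q^-1)) => h.
  have qVr : q^-1 \in r' by rewrite mem_cat map_f ?orbT.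
  by rewrite -(modM _ _ (rr' _ qr) qVr) mulgV (finite_model1 tpartP).
pose phi q (a : {perm H}) : {perm H} :=
  if pselect (injective (finite_model D tpart pi q)) is left i then a * perm i else a.
have phiE q (mi : injective (finite_model D tpart pi q)) a : phi q a = a * perm mi.
  rewrite /phi; case: pselect => // i; congr (_ * _).
  by apply/permP => h; rewrite !permE.
have exact_similar (f g : {perm H} -> {perm H}) : f =1 g -> Defs.similar eps f g.
  move=> fg; rewrite /Defs.similar eq_card0 ?mulr_ge0 ?ler0n ?(ltW eps0)// => a.
  by rewrite !inE fg eqxx.
exists {perm H}, phi; split => [e f er fr||e er e1].
- apply: exact_similar => a /=.
  have ef_inj : injective (finite_model D tpart pi (e * f)).
    move=> h h'; rewrite !modM ?rr'// => /(mod_inj _ fr); exact: mod_inj er h h'.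
  rewrite (phiE _ ef_inj) (phiE _ (mod_inj _ er)) (phiE _ (mod_inj _ fr)) -mulgA.
  by congr (_ * _); apply/permP => h; rewrite permM !permE modM ?rr'.
- apply: exact_similar => a.
  have inj1 : injective (finite_model D tpart pi 1).
    by move=> h h'; rewrite !(finite_model1 tpartP).
  rewrite (phiE _ inj1) -[RHS]mulg1; congr (_ * _); apply/permP => h.
  by rewrite permE perm1 (finite_model1 tpartP).
- rewrite /different /Defs.similar; apply/negP; rewrite -ltNge.
  have -> : #|[pred a | phi e a != id a]| = #|{: {perm H}}|.
    apply: eq_card => a; rewrite !inE (phiE _ (mod_inj _ er)); apply/eqP => aE.
    have xB : wit e \in B.
      by rewrite !mem_cat; apply/orP; right; apply/orP; left; exact: map_f.
    have exB : val e (wit e) \in B.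
      rewrite !mem_cat; apply/orP; right; apply/orP; right.
      exact: (map_f (fun q => val q (wit q))).
    have DB : {subset D e <= B}.
      move=> b bD; rewrite mem_cat; apply/orP; left; apply/flattenP.
      exists (window D e e); last by rewrite !mem_cat bD.
      by apply/allpairsP; exists (e, e); rewrite !rr'.
    apply: (witP e e1); apply: (piB) => //.
    have p1 : perm (mod_inj _ er) = 1 by apply: (mulgI a); rewrite mulg1.
    by rewrite -(finite_model_in tpartP piB DB xB) -(permE (mod_inj _ er)) p1 perm1.
  have A0 : (0 < #|{: {perm H}}|)%N by apply/card_gt0P; exists 1.
  by rewrite gtr_pMl ?ltr0n// ltrBlDr ltrDl.
Qed.

End AlmostTranslations.

End Soficity.

(** * Hyperbolic residually finite groups with property (T) *)

Unset Implicit Arguments.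

Theorem theorem3 (R : realType) (K : groupType)
  (K_infinite : infinite_set [set: K])
  (K_hyperbolic : hyperbolic R K)
  (K_resfinite : residually_finite K)
  (K_propertyT : property_T R K) :
  [/\ finitely_generated (groupQ K),
      sofic R (groupQ K)
    & ~ residually_amenable R (groupQ K)].
Proof.
split.
- have [S [_ [finS genS _ _]]] := K_hyperbolic.
  by apply: groupQ_finitely_generated; exists S.
- exact: groupQ_sofic.
- exact: groupQ_not_residually_amenable.
Qed.
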